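(* Let $N,k$ be positive integers with $N\ge 2k+1$, let $G$ be a connected $r$-regular graph on $m$ vertices, and let $X=C_N^k\square G$. For each $\alpha=1,\ldots,t$, assume that all roots of $D_{k,\nu_\alpha}(x)$ are simple. Furthermore, suppose that $G$ is walk-regular. Then, for any $a\in V(G)$ and $0\le\ell\le N-1$, we have $$h_X((0,a),(\ell,a))=\frac{2k+r}{2k}h_{C_N^k}(0,\ell)-\frac{N(2k+r)}{2}\sum_{\alpha=1}^{t}m_\alpha\sum_{c=1}^{k}\frac{1}{\gamma_{\alpha,c}D_{k,\nu_\alpha}'(\phi_{\alpha,c})}\frac{V_\ell^{(\alpha,c)}V_{N-\ell}^{(\alpha,c)}}{V_N^{(\alpha,c)}}.$$ In particular, the right-hand side is independent of the vertex $a$.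
   Context: All graphs are finite, simple and undirected; $\mathbb Z_N=\mathbb Z/N\mathbb Z$. $C_N^k$ is the graph with vertex set $\mathbb Z_N$ in which $x,y$ are adjacent iff $x-y\equiv\pm s\pmod N$ for some $1\le s\le k$ (it is $2k$-regular since $N\ge 2k+1$). $X=C_N^k\square G$ is the Cartesian product: vertex set $\mathbb Z_N\times V(G)$, with $(x,a)$ and $(y,b)$ adjacent iff ($a=b$ and $x,y$ are adjacent in $C_N^k$) or ($x=y$ and $a,b$ are adjacent in $G$). For a finite connected graph $Y$ and $u,v\in V(Y)$, $h_Y(u,v)$ is the expected value of $T_v=\inf\{t\ge 0: Z_t=v\}$ for the simple random walk $(Z_t)$ on $Y$ started at $u$ (each step moves to a uniformly random neighbour). A graph $G$ with adjacency matrix $A_G$ is walk-regular if for every integer $q\ge 0$ the diagonal entry $(A_G^q)(a,a)$ is independent of the vertex $a$. $L_G=rI_m-A_G$ is the Laplacian of $G$, with distinct eigenvalues $0=\nu_0<\nu_1<\cdots<\nu_t$; $m_\alpha$ is the multiplicity of $\nu_\alpha$. For $\nu>0$, $D_{k,\nu}(x)=k+\frac{\nu}{2}-\sum_{s=1}^{k}T_s\left(\frac{x}{2}\right)$, where $T_s$ is the Chebyshev polynomial of the first kind; it has degree $k$. When the roots of $D_{k,\nu_\alpha}$ are simple they are denoted $\phi_{\alpha,1},\ldots,\phi_{\alpha,k}\in\mathbb C$. For each $\alpha\in\{1,\ldots,t\}$ and $c\in\{1,\ldots,k\}$ choose $\rho_{\alpha,c}\in\mathbb C$ with $\rho_{\alpha,c}+\rho_{\alpha,c}^{-1}=\phi_{\alpha,c}$,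 choose $\eta_{\alpha,c}\in\mathbb C$ with $\eta_{\alpha,c}^2=\rho_{\alpha,c}$, and put $\gamma_{\alpha,c}=\eta_{\alpha,c}+\eta_{\alpha,c}^{-1}$. The sequence $(V_n^{(\alpha,c)})_{n\ge 0}$ is defined by $V_0^{(\alpha,c)}=0$, $V_1^{(\alpha,c)}=1$, $V_{n+2}^{(\alpha,c)}=\gamma_{\alpha,c}V_{n+1}^{(\alpha,c)}-V_n^{(\alpha,c)}$. *)

(* Defs.v *)
From HB Require Import structures.
From mathcomp Require Import all_boot all_order all_algebra.
From mathcomp Require Import complex.
From mathcomp Require Import all_classical all_reals all_analysis.

Set Implicit Arguments.
Unset Strict Implicit.
Unset Printing Implicit Defensive.

Import Order.TTheory GRing.Theory Num.Theory.
Import numFieldNormedType.Exports.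

Local Open Scope classical_set_scope.
Local Open Scope ring_scope.

Definition simple_graph (V : finType) (e : rel V) : Prop :=
  symmetric e /\ irreflexive e.

Definition connected_graph (V : finType) (e : rel V) : Prop :=
  (0 < #|V|)%N /\ forall x y : V, connect e x y.

Definition degree (V : finType) (e : rel V) (x : V) : nat := #|e x|.

Definition regular_graph (V : finType) (e : rel V) (r : nat) : Prop :=
  forall x : V, degree e x = r.

(* Note that 'Z_N is the ring of integers modulo N only when 1 < N. *)
Definition cycle_power (N k : nat) : rel 'Z_N :=
  fun x y => [exists s : 'I_k, (x - y == s.+1%:R) || (x - y == - s.+1%:R)].

Definition cartesian_product (V W : finType) (e : rel V) (f : rel W) :
    rel (V * W)%type :=
  fun p q => ((p.2 == q.2) && e p.1 q.1) || ((p.1 == q.1) && f p.2 q.2).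

Definition adjacency (R : pzRingType) (V : finType) (e : rel V) : 'M[R]_#|V| :=
  \matrix_(i, j) (e (enum_val i) (enum_val j))%:R.

Definition walk_regular (V : finType) (e : rel V) : Prop :=
  forall (q : nat) (a b : V),
    (adjacency int e ^+ q) (enum_rank a) (enum_rank a) =
    (adjacency int e ^+ q) (enum_rank b) (enum_rank b).

Definition laplacian (R : pzRingType) (V : finType) (e : rel V) (r : nat) :
    'M[R]_#|V| :=
  r%:R%:M - adjacency R e.

Definition transition (R : realType) (V : finType) (e : rel V) (x y : V) : R :=
  if e x y then (degree e x)%:R^-1 else 0.

(* The last field is the Markov property with one-step probabilities
   [transition], conditional probabilities being multiplied out so that
   trajectories of probability 0 need no separate treatment. *)
Record simple_random_walk (R : realType) (V : finType) (e : rel V)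
    (d : measure_display) (Omega : measurableType d) (P : probability Omega R)
    (Z : nat -> Omega -> V) (u : V) : Prop := SimpleRandomWalk {
  srw_measurable : forall (n : nat) (x : V), measurable (Z n @^-1` [set x]) ;
  srw_start : P (Z 0%N @^-1` [set u]) = 1%E ;
  srw_step : forall (n : nat) (z : nat -> V),
    P [set w | forall i, (i <= n.+1)%N -> Z i w = z i] =
    (P [set w | forall i, (i <= n)%N -> Z i w = z i] *
     (transition R e (z n) (z n.+1))%:E)%E
}.

(* The infimum of the empty set is +oo. *)
Definition hitting_time (R : realType) (V : finType) (Omega : Type)
    (Z : nat -> Omega -> V) (v : V) (w : Omega) : \bar R :=
  ereal_inf [set n%:R%:E | n in [set n | Z n w = v]].

(* This is the expectation of [hitting_time]; the library's 'E_P[X] is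
   restricted to real-valued X. *)
Definition mean_hitting_time (R : realType) (V : finType)
    (d : measure_display) (Omega : measurableType d) (P : probability Omega R)
    (Z : nat -> Omega -> V) (v : V) : \bar R :=
  (\int[P]_w hitting_time R Z v w)%E.

Fixpoint chebyshev (F : nzRingType) (n : nat) : {poly F} :=
  match n with
  | 0 => 1
  | 1 => 'X
  | (n''.+1 as n').+1 => 2%:R *: ('X * chebyshev F n') - chebyshev F n''
  end.

Definition Dpoly (F : fieldType) (k : nat) (nu : F) : {poly F} :=
  (k%:R + nu / 2%:R)%:P -
  \sum_(1 <= s < k.+1) (chebyshev F s \Po (2%:R^-1 *: 'X)).

Fixpoint Vseq (F : pzRingType) (gamma : F) (n : nat) : F :=
  match n with
  | 0 => 0
  | 1 => 1
  | (n''.+1 as n').+1 => gamma * Vseq gamma n' - Vseq gamma n''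
  end.

(* Main.v *)
(** Hitting times on a regular graph are the solution of a Poisson equation for
    the Laplacian.  On [C_N^k x G] it is solved by separation of variables: the
    zero eigenvalue of [L_G] contributes the hitting time of [C_N^k], and a
    nonzero eigenvalue [nu] the Green function of [L_C + nu] on the cycle,
    weighted by the diagonal entry of the spectral projection, which is
    (multiplicity of [nu])/[m] by walk-regularity.  With [S] the cyclic shift,
    [L_C + nu = 2 D_nu(S + S^-1)], so partial fractions of [1/D_nu] reduce this
    Green function to those of [phi - S - S^-1], whose closed form in [rho]
    becomes the quotient of the [V_n]. *)

Require Import Defs.
From HB Require Import structures.
From mathcomp Require Import all_boot all_order all_algebra.
From mathcomp Require Import complex.
From mathcomp Require Import zify ring.
From mathcomp Require Import all_classical all_reals all_analysis.

Set Implicit Arguments.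
Unset Strict Implicit.
Unset Printing Implicit Defensive.

Import Order.TTheory GRing.Theory Num.Theory.
Import numFieldNormedType.Exports.

Local Open Scope classical_set_scope.
Local Open Scope ring_scope.
Local Open Scope complex_scope.

(** * Spectral projections of real symmetric matrices *)

(** The denominators of the closed form have to be shown nonzero: a root [rho + rho^-1] of [D_nu]
    with [nu > 0] has [|rho| <> 1], so [rho^n <> 1] for all [n > 0], and neither [gamma] nor [V_N]
    vanishes. The spectral data of [G] are real but the roots of [D_nu] are complex. The Green
    function returns to the reals by uniqueness: its imaginary part solves a homogeneous equation
    with positive mass, so a maximum principle kills it. The superposition of Green functions solves
    the Poisson equation on all of [X], source term at the target included, but does not vanish at
    the target. Hence only its differences enter, and the [V_n] quotient is exactly such a
    difference. The factor [1/2] in the formula comes from [L_C + nu = 2 D_nu]; the size [m] of [G]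
    inside [|X| = N m] cancels the [m] in the diagonal entry [m_alpha / m]. *)

Section Lagrange.
Variables (F : fieldType) (n : nat) (x : 'I_n -> F).

Definition lagrange_poly (i : 'I_n) : {poly F} :=
  (\prod_(j | j != i) (x i - x j))^-1 *: \prod_(j | j != i) ('X - (x j)%:P).

Lemma mul_lagrange_poly (i : 'I_n) :
  ('X - (x i)%:P) * lagrange_poly i =
  (\prod_(j | j != i) (x i - x j))^-1 *: \prod_j ('X - (x j)%:P).
Proof. by rewrite -scalerAr [\prod_j _](bigD1 i). Qed.

Lemma size_lagrange_poly (i : 'I_n) : (size (lagrange_poly i) <= n)%N.
Proof.
apply: leq_trans (size_scale_leq _ _) _.
rewrite size_prod => [|j _]; last by rewrite polyXsubC_eq0.
under eq_bigr do rewrite size_XsubC.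
rewrite sum_nat_const mulnC mul2n -addnn -addSn addnK.
by rewrite cardC1 card_ord; case: (n) i => [[]|].
Qed.

Hypothesis x_inj : injective x.

Lemma horner_lagrange_poly (i j : 'I_n) : (lagrange_poly i).[x j] = (i == j)%:R.
Proof.
rewrite hornerZ horner_prod.
under [X in _ * X]eq_bigr do rewrite hornerXsubC.
have [<-|ij] := eqVneq i j.
  by rewrite mulVf //; apply/prodf_neq0 => l li; rewrite subr_eq0 inj_eq // eq_sym.
by rewrite [X in _ * X](bigD1 j) 1?eq_sym //= subrr mul0r mulr0.
Qed.

(** Both sides have degree below [n] and agree at [n] points. *)
Lemma sum_lagrange_poly : (0 < n)%N -> \sum_i lagrange_poly i = 1.
Proof.
move=> n_gt0; apply/eqP; rewrite -subr_eq0; apply/eqP.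
apply: (@roots_geq_poly_eq0 _ _ [seq x i | i <- enum 'I_n]).
- apply/allP => _ /mapP[j _ ->]; rewrite rootE !hornerE horner_sum.
  rewrite (bigD1 j) //= horner_lagrange_poly eqxx big1 ?addr0 ?subrr // => i.
  by rewrite horner_lagrange_poly => /negbTE->.
- by rewrite map_inj_uniq // enum_uniq.
- rewrite size_map size_enum_ord (leq_trans (size_polyD _ _)) // geq_max.
  rewrite size_polyN size_poly1 n_gt0 andbT (leq_trans (size_sum _ _ _)) //.
  by apply/bigmax_leqP => i _; exact: size_lagrange_poly.
Qed.

End Lagrange.

(** In a full-rank factorization [A = c r], cancelling [c] and [r] in [c r c r = c r] leaves
    [r c = 1], an identity matrix of size the rank. *)
Lemma mxtrace_idempotent (F : fieldType) (n : nat) (A : 'M[F]_n) :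
  A *m A = A -> \tr A = (\rank A)%:R.
Proof.
move=> AA; have := col_base_full A; rewrite /row_full -mxrank_tr.
move: (mulmx_base A) (row_base_free A); move: (col_base A) (row_base A).
move=> c r crA rfree cfree; rewrite -{1}crA mxtrace_mulC.
suff -> : r *m c = 1%:M by rewrite mxtrace1.
apply: (row_free_inj rfree); rewrite /= mul1mx.
apply/trmx_inj/(row_free_inj cfree); rewrite /= -!trmx_mul !mulmxA crA.
by rewrite -mulmxA crA AA.
Qed.

(** Over the complex numbers [M] is Hermitian, hence unitarily diagonalizable with real diagonal
    entries; these are eigenvalues of [M] itself, so the product vanishes at each of them. *)
Lemma symmetric_mx_annihilated (R : rcfType) (n t : nat) (M : 'M[R]_n.+1)
    (nu : 'I_t -> R) :
  M^T = M -> (forall x, eigenvalue M x -> exists i, nu i = x) ->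
  horner_mx M (\prod_i ('X - (nu i)%:P)) = 0.
Proof.
move=> MT nuP; set f := real_complex R.
pose MC := map_mx f M.
have Mherm : MC \is hermsymmx.
  apply: realsym_hermsym; last first.
    by apply/mxOverP => i j; rewrite mxE /f complex_real.
  apply/is_hermitianmxP; rewrite expr0 scale1r map_mx_id //.
  by rewrite map_trmx MT.
have /orthomx_spectralP MCE := hermitian_normalmx Mherm.
have dreal := hermitian_spectral_diag_real Mherm.
set P := spectralmx MC in MCE; set d := spectral_diag MC in MCE dreal.
have Pu : P \in unitmx by apply: spectral_unit.
have hornerE q : horner_mx MC q = invmx P *m horner_mx (diag_mx d) q *m P.
  have Vu : invmx P \is a GRing.unit by rewrite -[_ \is a _]/(invmx P \in unitmx) unitmx_inv.
  by have := horner_mx_uconj q (diag_mx d) Vu; rewrite invmxK -MCE.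
have deig j : exists i, (nu i)%:C = d 0 j.
  have /complex_realP[x dx] : d 0 j \is Num.real by move/mxOverP: dreal; apply.
  have : eigenvalue MC (d 0 j).
    apply/eigenvalueP; exists (row j P).
      by rewrite -row_mul MCE !mulmxA mulmxV // mul1mx row_mul row_diag_mx -scalemxAl -rowE.
    apply: contraTneq Pu => Pj0; rewrite -row_free_unit.
    by apply/row_freePn; exists j; rewrite Pj0 sub0mx.
  rewrite dx eigenvalue_root_char -map_char_poly fmorph_root -eigenvalue_root_char.
  by move=> /nuP[i <-]; exists i.
apply: (@map_mx_inj _ _ f); rewrite map_horner_mx map_mx0 hornerE horner_mx_diag.
rewrite (_ : map_mx _ d = 0) ?linear0 ?mulmx0 ?mul0mx //.
apply/rowP => j; rewrite !mxE rmorph_prod horner_prod.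
have [i <-] := deig j.
by rewrite (bigD1 i) //= map_polyXsubC hornerXsubC subrr mul0r.
Qed.

(** [E i] is the Lagrange polynomial of [nu i] evaluated at [M]. Being a polynomial in [M] is what
    lets walk-regularity control its diagonal; the last clause serves to compute the projection at
    eigenvalue [0]. *)
Lemma symmetric_mx_spectral_projections (R : rcfType) (n t : nat)
    (M : 'M[R]_n) (nu : 'I_t.+1 -> R) :
  M^T = M -> injective nu -> (forall x, eigenvalue M x -> exists i, nu i = x) ->
  exists E : 'I_t.+1 -> 'M[R]_n,
    [/\ \sum_i E i = 1%:M,
        forall i, M *m E i = nu i *: E i,
        forall i, \tr (E i) = (\rank (eigenspace M (nu i)))%:R,
        forall i, exists q (c : 'I_q -> R), E i = \sum_j c j *: M ^+ j &
        forall i j (v : 'rV_n), v *m M = nu i *: v ->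
          v *m E j = (i == j)%:R *: v].
Proof.
case: n M => [|n] M MT nu_inj nuP.
  exists (fun=> 0); split.
  - by apply/matrixP => -[].
  - by move=> i; apply/matrixP => -[].
  - move=> i; rewrite mxtrace0.
    by have := rank_leq_row (eigenspace M (nu i)); rewrite leqn0 => /eqP->.
  - move=> i; exists 0%N, (fun=> 0); by apply/matrixP => -[].
  - by move=> i j v _; apply/matrixP => ? -[].
pose E i := horner_mx M (lagrange_poly nu i).
have ME i : M *m E i = nu i *: E i.
  apply/eqP; rewrite -subr_eq0 -mul_scalar_mx -mulmxBl; apply/eqP.
  have -> : M - (nu i)%:M = horner_mx M ('X - (nu i)%:P).
    by rewrite rmorphB /= horner_mx_X horner_mx_C.
  rewrite -[_ *m _]/(_ * _) -rmorphM /= mul_lagrange_poly horner_mxZ.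
  by rewrite (symmetric_mx_annihilated MT nuP) scaler0.
have hornerE i (v : 'rV_n.+1) p : v *m M = nu i *: v ->
    v *m horner_mx M p = p.[nu i] *: v.
  move=> vM; elim/poly_ind: p => [|p c IHp]; first by rewrite rmorph0 mulmx0 horner0 scale0r.
  rewrite hornerMXaddC rmorphD rmorphM /= horner_mx_X horner_mx_C mulmxDr.
  by rewrite mulmxA IHp -scalemxAl vM scalerA mul_mx_scalar scalerDl.
have vE i j (v : 'rV_n.+1) : v *m M = nu i *: v -> v *m E j = (i == j)%:R *: v.
  by move=> /hornerE->; rewrite horner_lagrange_poly // eq_sym.
have EM i : E i *m M = nu i *: E i by rewrite -ME; apply: comm_horner_mx.
have rowEM i r : row r (E i) *m M = nu i *: row r (E i).
  by rewrite -row_mul EM linearZ.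
have EE i : E i *m E i = E i.
  by apply/row_matrixP => r; rewrite row_mul (vE i) // eqxx scale1r.
exists E; split=> //.
- by rewrite -rmorph_sum sum_lagrange_poly // rmorph1.
(* [E i] has the eigenspace as row space: its rows are eigenvectors, and it fixes every
   eigenvector. *)
- move=> i; rewrite mxtrace_idempotent //; congr _%:R; apply/eqP.
  rewrite eqn_leq; apply/andP; split; apply/mxrankS/row_subP => r.
    exact/eigenspaceP.
  have /eigenspaceP/(vE i i) : (row r (eigenspace M (nu i)) <= eigenspace M (nu i))%MS.
    exact: row_sub.
  by rewrite eqxx scale1r => <-; exact: submxMl.
- move=> i; exists (size (lagrange_poly nu i)), (fun j => (lagrange_poly nu i)`_j).
  rewrite /E -[X in horner_mx _ X]coefK poly_def rmorph_sum; apply: eq_bigr => j _.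
  by rewrite /= horner_mxZ rmorphXn /= horner_mx_X.
Qed.

(** * Mean hitting times *)

Lemma fine_measure_partition (R : realType) (d : measure_display)
    (Omega : measurableType d) (P : probability Omega R) (T : finType)
    (f : Omega -> T) (B : set Omega) :
  measurable B -> (forall x, measurable (B `&` f @^-1` [set x])) ->
  fine (P B) = \sum_x fine (P (B `&` f @^-1` [set x])).
Proof.
move=> mB mBf; apply: EFin_inj; rewrite -sumEFin fineK ?fin_num_measure //.
under eq_bigr => x _ do rewrite fineK ?fin_num_measure //.
rewrite fsbig_seq ?index_enum_uniq // -measure_fin_bigcup //; last 1 first.
  by move=> x y _ _ [w [[_ /= ->] [_ /= ->]]].
congr (P _); apply/seteqP; split=> [w Bw|w [x _ []//]].
by exists (f w) => //=; rewrite mem_index_enum.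
Qed.

Section HittingTime.
Context (R : realType) (V : finType) (e : rel V) (d : measure_display)
  (Omega : measurableType d) (P : probability Omega R) (Z : nat -> Omega -> V)
  (u : V) (Zsrw : simple_random_walk e P Z u) (v : V).

(** The event that the hitting time exceeds [n]. *)
Definition avoid (n : nat) : set Omega :=
  [set w | forall i, (i <= n)%N -> Z i w != v].

(** The law at time [n] of the walk killed on reaching [v], a subprobability. *)
Definition taboo_prob (n : nat) (x : V) : R :=
  fine (P (avoid n `&` Z n @^-1` [set x])).

Lemma measurable_avoid (n : nat) : measurable (avoid n).
Proof.
have -> : avoid n = \bigcap_(i in [set i | (i <= n)%N]) ~` (Z i @^-1` [set v]).
  apply/seteqP; split=> w /= h i /= /h; first by move/eqP.
  by move=> ?; apply/eqP.
apply: bigcap_measurableType => i _; apply: measurableC; exact: srw_measurable Zsrw _ _.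
Qed.

Let measurable_path (n : nat) (z : nat -> V) :
  measurable [set w | forall i, (i <= n)%N -> Z i w = z i].
Proof.
have -> : [set w | forall i, (i <= n)%N -> Z i w = z i] =
    \bigcap_(i in [set i | (i <= n)%N]) (Z i @^-1` [set z i]).
  by apply/seteqP; split=> w.
by apply: bigcap_measurableType => i _; exact: srw_measurable Zsrw _ _.
Qed.

Lemma fine_avoid (n : nat) : fine (P (avoid n)) = \sum_x taboo_prob n x.
Proof.
apply: fine_measure_partition => [|x]; first exact: measurable_avoid.
by apply: measurableI; [exact: measurable_avoid|exact: srw_measurable Zsrw _ _].
Qed.

Lemma taboo_prob_v (n : nat) : taboo_prob n v = 0.
Proof.
rewrite /taboo_prob (_ : _ `&` _ = set0) ?measure0 //.
by apply/seteqP; split=> // w [/(_ n (leqnn n))/eqP].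
Qed.

(** The Markov property is given on single trajectories only, so both sides are expanded over all
    paths of [n.+1] vertices that avoid [v]. *)
Lemma taboo_prob_step (n : nat) (y : V) : y != v ->
  taboo_prob n.+1 y = \sum_x taboo_prob n x * transition R e x y.
Proof.
move=> yv.
pose path w : {ffun 'I_n.+1 -> V} := [ffun i : 'I_n.+1 => Z i w].
pose cyl z := path @^-1` [set z].
have cylE z : cyl z = [set w | forall i, (i <= n)%N -> Z i w = z (inord i)].
  apply/seteqP; split=> w /= => [<- i ilen|h]; first by rewrite ffunE inordK.
  by apply/ffunP => i; rewrite ffunE h ?inord_val // -ltnS.
have mcyl z : measurable (cyl z) by rewrite cylE.
pose avoids (z : {ffun 'I_n.+1 -> V}) := [forall i, z i != v].
have avoidE z w : cyl z w -> avoid n w <-> avoids z.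
  rewrite cylE => cw; split=> [h|/forallP h i ilen]; last by rewrite cw.
  by apply/forallP => j; rewrite -[j]inord_val -cw ?h // -ltnS.
have mZ m x : measurable (Z m @^-1` [set x]) by exact: srw_measurable Zsrw _ _.
have mA m := measurable_avoid m.
have SE x : taboo_prob n x =
    \sum_z (avoids z && (z ord_max == x))%:R * fine (P (cyl z)).
  rewrite /taboo_prob (@fine_measure_partition _ _ _ _ _ path) //; last 2 first.
  - exact: measurableI.
  - by move=> z; apply: measurableI; [exact: measurableI|exact: mcyl].
  apply: eq_bigr => z _; have [/andP[az /eqP cx]|] := boolP (_ && _).
    rewrite mul1r; congr (fine (P _)); apply/seteqP; split=> [w []//|w cw].
    split=> //; split; first exact/(avoidE _ _ cw).
    by rewrite /= -cx -{}cw ffunE.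
  move=> nz; rewrite mul0r (_ : _ `&` _ = set0) ?measure0 //.
  apply/seteqP; split=> // w [[aw /= Zx] cw].
  by move/negP: nz; apply; rewrite (iffLR (avoidE _ _ cw) aw) -{}cw ffunE Zx eqxx.
have SnE : taboo_prob n.+1 y =
    \sum_z (avoids z)%:R * (fine (P (cyl z)) * transition R e (z ord_max) y).
  rewrite /taboo_prob (@fine_measure_partition _ _ _ _ _ path) //; last 2 first.
  - exact: measurableI.
  - by move=> z; apply: measurableI; [exact: measurableI|exact: mcyl].
  apply: eq_bigr => z _; have [az|nz] := boolP (avoids z); last first.
    rewrite mul0r (_ : _ `&` _ = set0) ?measure0 //.
    apply/seteqP; split=> // w [[aw /= Zx] cw].
    move/negP: nz; apply; apply/(avoidE _ _ cw) => i ilen; apply: aw.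
    exact: leqW.
  rewrite mul1r.
  (* The path [z] prolonged by a step to [y], as the infinite trajectory that [srw_step] expects. *)
  pose zy i := if (i <= n)%N then z (inord i) else y.
  have := srw_step Zsrw n zy; rewrite {3}/zy leqnn {3}/zy ltnn.
  rewrite (_ : inord n = ord_max); last by apply: val_inj; rewrite /= inordK.
  rewrite [X in (P X * _)%E](_ : _ = cyl z); last first.
    by rewrite cylE; apply/seteqP; split=> w /= h i ilen; rewrite h // /zy ilen //.
  rewrite -[P (cyl z)]fineK ?fin_num_measure // -EFinM => /(congr1 fine) /= <-.
  congr (fine (P _)); rewrite -/(cyl z) cylE; apply/seteqP; split=> w /=.
    move=> [[_ Zy] cw] i; rewrite leq_eqVlt ltnS => /orP[/eqP->|ilen].
      by rewrite /zy ltnn.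
    by rewrite /zy ilen cw.
  move=> h; have hz i : (i <= n)%N -> Z i w = z (inord i).
    by move=> ilen; rewrite h ?leqW // /zy ilen.
  have Zy : Z n.+1 w = y by rewrite h // /zy ltnn.
  split=> //; split=> // i; rewrite leq_eqVlt ltnS => /orP[/eqP->|ilen].
    by rewrite Zy.
  by rewrite hz //; move/forallP: az; apply.
rewrite SnE.
under [RHS]eq_bigr do rewrite SE mulr_suml.
rewrite exchange_big; apply: eq_bigr => z _.
rewrite (bigD1 (z ord_max)) //= eqxx andbT -mulrA big1 ?addr0 // => x.
by rewrite eq_sym => /negbTE->; rewrite andbF !mul0r.
Qed.

(** The killed walk starts as the point mass at [u], or as zero if [u = v]; the condition [f v = 0]
    covers both cases at once. *)
Lemma taboo_prob_start (f : V -> R) : f v = 0 ->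
  \sum_x taboo_prob 0 x * f x = f u.
Proof.
have mZ x : measurable (Z 0%N @^-1` [set x]) by exact: srw_measurable Zsrw _ _.
have P0 x : x != u -> P (Z 0%N @^-1` [set x]) = 0.
  move=> xu; apply/eqP; rewrite -measure_le0.
  have <- : P (~` (Z 0%N @^-1` [set u])) = 0.
    by rewrite probability_setC // (srw_start Zsrw) subee.
  rewrite le_measure ?inE //; first exact: measurableC.
  by move=> w /= -> ux; move/eqP: xu.
move=> fv; have [uv|uv] := eqVneq u v.
  rewrite uv fv big1 // => x _; have [->|xv] := eqVneq x v; first by rewrite fv mulr0.
  rewrite /taboo_prob (_ : P _ = 0) ?mul0r //; apply/eqP; rewrite -measure_le0.
  rewrite -(P0 x) ?uv // le_measure ?inE //.
  by apply: measurableI; [exact: measurable_avoid|exact: mZ].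
rewrite (bigD1 u) //= big1 ?addr0 => [|x xu]; last first.
  rewrite /taboo_prob (_ : P _ = 0) ?mul0r //; apply/eqP; rewrite -measure_le0.
  rewrite -(P0 x) // le_measure ?inE //.
  by apply: measurableI; [exact: measurable_avoid|exact: mZ].
rewrite /taboo_prob (_ : _ `&` _ = Z 0%N @^-1` [set u]) ?(srw_start Zsrw) ?mul1r //.
apply/seteqP; split=> [w []//|w /= Zw]; split=> // i.
by rewrite leqn0 => /eqP->; rewrite Zw.
Qed.

(** The tail-sum formula, pathwise: [n] contributes [1] exactly when the hitting time exceeds
    [n]. *)
Lemma hitting_time_sum_avoid (w : Omega) :
  hitting_time R Z v w = (\sum_(0 <= n <oo) (\1_(avoid n) w)%:E)%E.
Proof.
have term_ge0 n : (0 <= (\1_(avoid n) w)%:E :> \bar R)%E by rewrite lee_fin.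
have [[n0 hit]|nohit] := pselect (exists n, Z n w = v).
  have hitb : exists n, Z n w == v by exists n0; apply/eqP.
  pose tau := ex_minn hitb.
  have [Ztau taumin] : Z tau w = v /\ forall n, Z n w = v -> (tau <= n)%N.
    rewrite /tau; case: ex_minnP => m /eqP Zm mmin; split=> // n /eqP; exact: mmin.
  have in_avoid n : (n < tau)%N -> \1_(avoid n) w = 1 :> R.
    move=> ntau; rewrite indicE mem_set // => i ilen; apply/eqP => /taumin.
    by rewrite leqNgt (leq_ltn_trans ilen ntau).
  have notin_avoid n : (tau <= n)%N -> \1_(avoid n) w = 0 :> R.
    by move=> taun; rewrite indicE memNset // => /(_ _ taun); rewrite Ztau eqxx.
  rewrite (nneseries_split 0 tau) // [X in (_ + X)%E]eseries0; last first.
    by move=> n; rewrite add0n => taun _; rewrite notin_avoid.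
  rewrite adde0 add0n sumEFin big_mkord.
  under eq_bigr => n _ do rewrite in_avoid //.
  rewrite sumr_const card_ord; apply/eqP; rewrite eq_le; apply/andP; split.
    by apply: ereal_inf_lbound; exists tau.
  by apply: le_ereal_inf_tmp => _ [n /= Zn <-]; rewrite lee_fin ler_nat taumin.
(* If [v] is never hit, both sides are [+oo]: the partial sums exceed every real. *)
rewrite /hitting_time (_ : [set n | _] = set0); last first.
  by apply/seteqP; split=> // n /= Zn; apply: nohit; exists n.
rewrite image_set0 ereal_inf0; apply/esym/eqyP => A A0.
have := archi_boundP (ltW A0); set n := Num.Def.archi_bound A => An.
apply: le_trans (nneseries_lim_ge n _) => //.
rewrite sumEFin big_mkord lee_fin.
under eq_bigr => i _.
  rewrite indicE mem_set; last by move=> j _; apply/eqP => Zj; apply: nohit; exists j.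
  over.
by rewrite sumr_const card_ord ltW.
Qed.

Lemma mean_hitting_time_avoid :
  mean_hitting_time P Z v = (\sum_(0 <= n <oo) P (avoid n))%E.
Proof.
rewrite /mean_hitting_time; under eq_integral do rewrite hitting_time_sum_avoid.
rewrite integral_nneseries //; last first.
  move=> n; apply/measurable_realfun.measurable_EFinP; apply: measurable_realfun.measurable_indic.
  exact: measurable_avoid.
apply: eq_eseriesr => n _.
by rewrite integral_indic ?setIT //; exact: measurable_avoid.
Qed.

(* Summing the equation for [h] against the law of the walk killed at [v]
   telescopes to [sum_(i < n) P(T > i) = h u - E(h(Z_n); T > n)]; the last term
   is at most [max h * P(T > n)], and [P(T > n)] tends to [0] because the
   partial sums are bounded by [h u]. *)
Lemma mean_hitting_time_eq (h : V -> R) : h v = 0 -> (forall x, 0 <= h x) ->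
  (forall x, x != v -> h x = 1 + \sum_y transition R e x y * h y) ->
  mean_hitting_time P Z v = (h u)%:E.
Proof.
move=> hv h_ge0 hE.
pose s n := fine (P (avoid n)).
pose rem n := \sum_x taboo_prob n x * h x.
have taboo_ge0 n x : 0 <= taboo_prob n x by rewrite fine_ge0.
have rem_ge0 n : 0 <= rem n by apply: sumr_ge0 => x _; exact: mulr_ge0.
have s_ge0 n : 0 <= s n by rewrite fine_ge0.
have remS n : rem n.+1 = rem n - s n.
  rewrite /s fine_avoid /rem -sumrB.
  transitivity (\sum_x \sum_y taboo_prob n y * (transition R e y x * h x)).
    apply: eq_bigr => x _; have [->|xv] := eqVneq x v.
      by rewrite hv mulr0 big1 // => y _; rewrite !mulr0.
    by rewrite taboo_prob_step // mulr_suml; apply: eq_bigr => y _; rewrite mulrA.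
  rewrite exchange_big; apply: eq_bigr => y _; rewrite -mulr_sumr.
  have [->|yv] := eqVneq y v; first by rewrite taboo_prob_v !mul0r subr0.
  by rewrite [h y]hE // mulrDr mulr1 addrC addKr.
have seriesE n : series s n = h u - rem n.
  elim: n => [|n IHn].
    by rewrite /series /= big_geq // /rem taboo_prob_start // subrr.
  by rewrite seriesSr IHn remS opprB addrA addrAC.
have s_to0 : s n @[n --> \oo] --> 0.
  apply: cvg_series_cvg_0; apply: nondecreasing_is_cvgn.
    apply/nondecreasing_seqP => n; by rewrite !seriesE remS lerD2l lerN2 gerBl.
  by exists (h u) => _ [n _ <-]; rewrite seriesE gerBl.
have rem_to0 : rem n @[n --> \oo] --> 0.
  pose M := \sum_x h x.
  have : M * s n @[n --> \oo] --> M * 0 by apply: cvgMr; exact: s_to0.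
  rewrite mulr0; apply: squeeze_cvgr; last exact: cvg_cst.
  near=> n; rewrite rem_ge0 /= /s fine_avoid mulr_sumr; apply: ler_sum => x _.
  rewrite mulrC ler_wpM2r // /M (bigD1 x) //= lerDl.
  by apply: sumr_ge0.
rewrite mean_hitting_time_avoid; apply: cvg_lim => //.
have -> : (fun n => \sum_(0 <= i < n) P (avoid i))%E = EFin \o series s.
  apply/funext => n /=; rewrite /series /= -sumEFin; apply: eq_bigr => i _.
  by rewrite /s fineK // fin_num_measure //; exact: measurable_avoid.
apply: cvg_EFin; first by near=> n.
have -> : fine \o (EFin \o series s) = fun n => h u - rem n.
  by apply/funext => n /=; rewrite seriesE.
by rewrite -[X in _ --> X]subr0; apply: cvgB; [exact: cvg_cst|].
Unshelve. all: by end_near. Qed.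

End HittingTime.

(** * Maximum principle and the Poisson equation on regular graphs *)

Section MaximumPrinciple.
Context (R : realFieldType) (W : finType) (e : rel W) (q : nat)
  (ereg : regular_graph e q).

Lemma sum_neighbors_const (x : W) (c : R) : \sum_(y | e x y) c = q%:R * c.
Proof. by rewrite sumr_const -(ereg x) mulr_natl. Qed.

Lemma exists_max (f : W -> R) (x0 : W) : exists x, forall y, f y <= f x.
Proof. by case: (@arg_maxP _ _ _ x0 predT f isT) => x _ h; exists x => y; exact: h. Qed.

(** At a maximum [z] of a solution [g], the neighbour sum is at most [q * g z], so [nu * g z <= 0]
    and [g <= 0]. The same holds for [- g]. *)
Lemma massive_laplacian_inj (nu : R) (f : W -> R) : 0 < nu ->
  (forall x, (q%:R + nu) * f x - \sum_(y | e x y) f y = 0) -> f =1 fun=> 0.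
Proof.
move=> nu_gt0 fE.
have le0 (g : W -> R) : (forall x, (q%:R + nu) * g x - \sum_(y | e x y) g y = 0) ->
    forall x, g x <= 0.
  move=> gE x; have [z gz] := exists_max g x; apply: le_trans (gz x) _.
  rewrite -(pmulr_rle0 _ nu_gt0) -(lerD2l (q%:R * g z)) addr0 -mulrDl.
  move/eqP: (gE z); rewrite subr_eq0 => /eqP->; rewrite -(sum_neighbors_const z).
  by apply: ler_sum => y _.
move=> x; apply/le_anti/andP; split; first exact: le0.
rewrite -oppr_le0; apply: (le0 (fun y => - f y)) => y.
by rewrite sumrN mulrN -opprD fE oppr0.
Qed.

(** At a minimum the left side is at most [0 < q], so the minimum can only be at [v]. *)
Lemma poisson_ge0 (v : W) (h : W -> R) : (0 < q)%N -> h v = 0 ->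
  (forall x, x != v -> q%:R * h x - \sum_(y | e x y) h y = q%:R) ->
  forall x, 0 <= h x.
Proof.
move=> q_gt0 hv hE x; have [z hz] := exists_max (fun y => - h y) x.
have [zv|/hE hzE] := eqVneq z v; first by have := hz x; rewrite zv hv oppr0 oppr_le0.
suff : (0 : R) < 0 by rewrite ltxx.
rewrite -[ltRHS](subrr (q%:R * h z)); apply: lt_le_trans (_ : q%:R <= _).
  by rewrite ltr0n.
rewrite -{1}hzE lerD2l lerN2 -(sum_neighbors_const z); apply: ler_sum => y _.
by rewrite -lerN2.
Qed.

Hypothesis econn : forall x y, connect e x y.

(** A maximum off [v] is shared by all neighbours; following a path to [v] shows that it equals
    [0]. *)
Lemma harmonic_off_eq0 (v : W) (f : W -> R) : f v = 0 ->
  (forall x, x != v -> q%:R * f x - \sum_(y | e x y) f y = 0) -> f =1 fun=> 0.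
Proof.
move=> fv0 fE0.
have le0 (g : W -> R) : g v = 0 ->
    (forall x, x != v -> q%:R * g x - \sum_(y | e x y) g y = 0) ->
    forall x, g x <= 0.
  move=> gv gE x; have [z gz] := exists_max g x; apply: le_trans (gz x) _.
  have /connectP[p] := econn z v.
  elim: p z gz => [z _ _ /= vz|y p IHp z gz /= /andP[zy yp] vE]; first by rewrite -vz gv.
  have [->|/gE] := eqVneq z v; first by rewrite gv.
  rewrite -(sum_neighbors_const z) -sumrB => /psumr_eq0P gzy.
  have /eqP : g z - g y = 0 by apply: gzy => // i _; rewrite subr_ge0.
  rewrite subr_eq0 => /eqP gE'; rewrite gE'; apply: IHp => // i; rewrite -gE'.
  exact: gz.
move=> x; apply/le_anti/andP; split; first exact: le0.
rewrite -oppr_le0; apply: (le0 (fun y => - f y)) => [|y yv]; first by rewrite fv0 oppr0.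
by rewrite sumrN mulrN -opprD fE0 ?oppr0.
Qed.

Lemma exists_poisson (v : W) : exists h : W -> R, h v = 0 /\
  forall x, x != v -> q%:R * h x - \sum_(y | e x y) h y = q%:R.
Proof.
(* The Laplacian, acting on row vectors, with the equation at [v] replaced by the normalization
   [h v = 0]; it is invertible by [harmonic_off_eq0]. *)
pose A := \matrix_(j, i < #|W|)
  (if enum_val i == v then (j == i)%:R
   else q%:R * (j == i)%:R - (e (enum_val i) (enum_val j))%:R) : 'M[R]_#|W|.
have AE (f : 'rV[R]_#|W|) (x : W) : (f *m A) 0 (enum_rank x) =
    if x == v then f 0 (enum_rank x)
    else q%:R * f 0 (enum_rank x) - \sum_(y | e x y) f 0 (enum_rank y).
  rewrite mxE; under eq_bigr do rewrite mxE enum_rankK.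
  have deltaE (g : 'I_#|W| -> R) i : \sum_j g j * (j == i)%:R = g i.
    rewrite (bigD1 i) //= eqxx mulr1 big1 ?addr0 // => j /negbTE->.
    by rewrite mulr0.
  case: ifP => _; first exact: deltaE.
  under eq_bigr do rewrite mulrBr mulrCA.
  rewrite sumrB -mulr_sumr deltaE; congr (_ - _).
  rewrite (reindex enum_rank) /=; last by apply: onW_bij; exact: enum_rank_bij.
  rewrite [RHS]big_mkcond; apply: eq_bigr => y _; rewrite enum_rankK.
  by case: (e x y); rewrite ?mulr1 ?mulr0.
have Au : A \in unitmx.
  rewrite -row_free_unit; apply: inj_row_free => f fA0.
  have f0 := @harmonic_off_eq0 v (fun x => f 0 (enum_rank x)).
  apply/rowP => j; rewrite -[j]enum_valK mxE; apply: f0.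
    by have := AE f v; rewrite fA0 eqxx mxE.
  by move=> x xv; have := AE f x; rewrite fA0 (negbTE xv) mxE.
pose b := \row_(i < #|W|) (if enum_val i == v then 0 else q%:R) : 'rV[R]_#|W|.
exists (fun x => (b *m invmx A) 0 (enum_rank x)).
have hE x : (b *m invmx A *m A) 0 (enum_rank x) = if x == v then 0 else q%:R.
  by rewrite mulmxKV // mxE enum_rankK.
split; first by have := AE (b *m invmx A) v; rewrite hE eqxx.
by move=> x xv; have := AE (b *m invmx A) x; rewrite hE (negbTE xv).
Qed.

End MaximumPrinciple.

Lemma mean_hitting_time_regular (R : realType) (V : finType) (e : rel V)
    (q : nat) (d : measure_display) (Omega : measurableType d)
    (P : probability Omega R) (Z : nat -> Omega -> V) (u v : V) (h : V -> R) :
  regular_graph e q -> (0 < q)%N -> simple_random_walk e P Z u -> h v = 0 ->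
  (forall x, x != v -> q%:R * h x - \sum_(y | e x y) h y = q%:R) ->
  mean_hitting_time P Z v = (h u)%:E.
Proof.
move=> ereg q_gt0 Zsrw hv hE; have q_neq0 : q%:R != 0 :> R by rewrite pnatr_eq0 -lt0n.
apply: (mean_hitting_time_eq Zsrw) => // [|x xv].
  exact: (poisson_ge0 ereg q_gt0 hv hE).
apply: (mulfI q_neq0); rewrite mulrDr mulr1.
move/eqP: (hE x xv); rewrite subr_eq => /eqP ->; congr (_ + _).
rewrite mulr_sumr big_mkcond; apply: eq_bigr => y _; rewrite /transition ereg.
by case: (e x y); rewrite ?mulVKf // mul0r mulr0.
Qed.

(** * Green functions on powers of cycles *)

Lemma natr_Zp_inj (N m n : nat) : (1 < N)%N -> (m < N)%N -> (n < N)%N ->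
  m%:R = n%:R :> 'Z_N -> m = n.
Proof.
by move=> N_gt1 mN nN /(congr1 val); rewrite /= !val_Zp_nat // !modn_small.
Qed.

Section CyclePower.
Variables (N k : nat) (k_gt0 : (0 < k)%N) (Nk : (2 * k + 1 <= N)%N).

Let N_gt1 : (1 < N)%N. Proof. by lia. Qed.

(** The bound [2 * k + 1 <= N] makes the [2 * k] shifts of [x] pairwise distinct, so no neighbour is
    counted twice. *)
Lemma sum_cycle_power (M : nmodType) (f : 'Z_N -> M) (x : 'Z_N) :
  \sum_(y | cycle_power k x y) f y =
  \sum_(s < k) (f (x + s.+1%:R) + f (x - s.+1%:R)).
Proof.
pose nbr (p : 'I_k + 'I_k) : 'Z_N :=
  match p with inl s => x + s.+1%:R | inr s => x - s.+1%:R end.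
have nbr_neq (s s' : 'I_k) : x + s.+1%:R <> x - s'.+1%:R.
  move=> /addrI/eqP; rewrite -addr_eq0 -natrD => /eqP/(@natr_Zp_inj _ _ 0 N_gt1).
  by have := ltn_ord s; have := ltn_ord s'; lia.
have inj_nat (s s' : 'I_k) : s.+1%:R = s'.+1%:R :> 'Z_N -> s = s'.
  move=> /(natr_Zp_inj N_gt1) ss'; apply/val_inj/succn_inj/ss'.
    by have := ltn_ord s; lia.
  by have := ltn_ord s'; lia.
have nbr_inj : injective nbr.
  move=> [s|s] [s'|s'] /= => [/addrI/inj_nat->|/nbr_neq|/esym/nbr_neq|] //.
  by move=> /addrI/oppr_inj/inj_nat->.
transitivity (\sum_(y in [set nbr p | p in [set: ('I_k + 'I_k)%type]]%SET) f y).
  apply: eq_bigl => y; apply/existsP/imsetP => [[s /orP[]/eqP xy]|[[s|s] _ ->]].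
  - by exists (inr s); rewrite ?inE //= -xy opprB addrC subrK.
  - exists (inl s); rewrite ?inE //=.
    by rewrite -[s.+1%:R]opprK -xy opprB addrC subrK.
  - by exists s; rewrite /= opprD addNKr eqxx orbT.
  - by exists s; rewrite /= opprB addrC subrK eqxx.
rewrite big_imset /=; last by move=> p p' _ _; exact: nbr_inj.
rewrite (eq_bigl xpredT) => [|p]; last by rewrite inE.
by rewrite big_sumType big_split.
Qed.

Lemma regular_cycle_power : regular_graph (@cycle_power N k) (2 * k).
Proof.
move=> x; rewrite /degree -sum1_card (sum_cycle_power (fun=> 1%N)).
by rewrite sum_nat_const card_ord mulnC.
Qed.

Lemma connected_cycle_power (x y : 'Z_N) : connect (@cycle_power N k) x y.
Proof.
have step z : cycle_power k z (z + 1).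
  apply/existsP; exists (Ordinal k_gt0); rewrite opprD addNKr /= eqxx.
  by rewrite orbT.
have conn n : connect (@cycle_power N k) x (x + n%:R).
  elim: n => [|n IHn]; first by rewrite addr0 connect0.
  by apply: connect_trans IHn _; rewrite -natr1 addrA connect1.
by rewrite -[y](subrK x) addrC -[y - x]natr_Zp.
Qed.

End CyclePower.

(** * Chebyshev polynomials and the roots of [Dpoly] *)

Section Chebyshev.
Variable F : numFieldType.

Let half_chebyshev (s : nat) : {poly F} := Defs.chebyshev F s \Po (2%:R^-1 *: 'X).

Let half_chebyshevS (s : nat) :
  half_chebyshev s.+2 = 'X * half_chebyshev s.+1 - half_chebyshev s.
Proof.
rewrite /half_chebyshev /= comp_polyB comp_polyZ comp_polyM comp_polyX.
by rewrite -scalerAl scalerA divff ?scale1r // pnatr_eq0.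
Qed.

(** The upper bound suffices: [partial_fractions] recovers the exact degree from the number of
    roots. *)
Lemma size_Dpoly (k : nat) (nu : F) : (size (Dpoly k nu) <= k.+1)%N.
Proof.
have size_half s : (size (half_chebyshev s) <= s.+1)%N.
  have [] : (size (half_chebyshev s) <= s.+1)%N /\
            (size (half_chebyshev s.+1) <= s.+2)%N; last by [].
  elim: s => [|s [IH1 IH2]].
    rewrite /half_chebyshev /= comp_polyC size_poly1 comp_polyX; split=> //.
    by rewrite (leq_trans (size_scale_leq _ _)) // size_polyX.
  split=> //; rewrite half_chebyshevS (leq_trans (size_polyD _ _)) // geq_max.
  rewrite size_polyN (leq_trans IH1) ?andbT; last by lia.
  by rewrite (leq_trans (size_polyMleq _ _)) // size_polyX.
rewrite /Dpoly (leq_trans (size_polyD _ _)) // geq_max size_polyN.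
rewrite (leq_trans (size_polyC_leq1 _)) //=.
rewrite (leq_trans (size_sum _ _ _)) // big_nat_cond.
elim/big_ind : _ => // [m n mk nk|s]; first by rewrite geq_max mk nk.
by rewrite andbT ltnS => /andP[_ sk]; rewrite (leq_trans (size_half s)).
Qed.

(** This rests on [2 T_s((S + S^-1)/2) = S^s + S^-s]. An arbitrary morphism [f] covers both
    evaluation at a scalar and evaluation at a shift matrix. *)
Lemma rmorph_Dpoly (A : nzRingType) (f : {rmorphism {poly F} -> A}) (S S' : A)
    (k : nat) (nu : F) : S * S' = 1 -> S' * S = 1 -> f 'X = S + S' ->
  f (Dpoly k nu) *+ 2 =
  f (2 * k%:R + nu)%:P - \sum_(s < k) (S ^+ s.+1 + S' ^+ s.+1).
Proof.
move=> SS' S'S fX.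
have fhalf s : f (half_chebyshev s) *+ 2 = S ^+ s + S' ^+ s.
  have [] : f (half_chebyshev s) *+ 2 = S ^+ s + S' ^+ s /\
    f (half_chebyshev s.+1) *+ 2 = S ^+ s.+1 + S' ^+ s.+1; last by [].
  elim: s => [|s [IH1 IH2]].
    rewrite /half_chebyshev /= comp_polyC rmorph1 comp_polyX; split=> //.
    by rewrite -rmorphMn -scaler_nat scalerA divff ?pnatr_eq0 // scale1r fX.
  split=> //; rewrite half_chebyshevS rmorphB rmorphM /= fX mulrnBl -mulrnAr IH2 IH1.
  rewrite mulrDr !mulrDl -!exprS addrACA.
  have -> : S * S' ^+ s.+1 = S' ^+ s by rewrite exprS mulrA SS' mul1r.
  have -> : S' * S ^+ s.+1 = S ^+ s by rewrite exprS mulrA S'S mul1r.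
  move: (S ^+ s.+2) (S' ^+ s) (S ^+ s) (S' ^+ s.+2) => a b c b'.
  by rewrite [c + b']addrC addrACA [c + b]addrC addrK.
rewrite /Dpoly rmorphB mulrnBl -rmorphMn -polyCMn /= rmorph_sum; congr (f _%:P - _).
  by rewrite mulrnDl -[_ / _ *+ 2]mulr_natr divfK ?pnatr_eq0 // [2 * _]mulr_natl.
rewrite -sumrMnl big_add1 /= big_mkord; apply: eq_bigr => s _; exact: (fhalf s.+1).
Qed.

Lemma horner_Dpoly (k : nat) (nu rho : F) : rho != 0 ->
  (Dpoly k nu).[rho + rho^-1] *+ 2 =
  2 * k%:R + nu - \sum_(s < k) (rho ^+ s.+1 + rho^-1 ^+ s.+1).
Proof.
move=> rho0; have /= := @rmorph_Dpoly _ (horner_eval (rho + rho^-1)) rho rho^-1 k nu.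
rewrite /horner_eval hornerC => -> //; [exact: mulfV|exact: mulVf|exact: hornerX].
Qed.

(** At [rho = 1] the power sums cancel the degree, so [2 D(2) = nu]. *)
Lemma Dpoly_neq0 (k : nat) (nu : F) : nu != 0 -> Dpoly k nu != 0.
Proof.
apply: contra_neq => D0; have := horner_Dpoly k nu (oner_neq0 F).
rewrite D0 horner0 mul0rn invr1.
under eq_bigr do rewrite !expr1n.
by rewrite sumr_const card_ord [2 * _]mulr_natr addrAC subrr add0r => <-.
Qed.

(* The value at [2 cos theta] is half of an eigenvalue of [L + nu], [L] being
   the positive semidefinite Laplacian of the infinite [2k]-regular circulant. *)
Lemma Dpoly_root_norm_neq1 (k : nat) (nu rho : F) : 0 < nu ->
  root (Dpoly k nu) (rho + rho^-1) -> `|rho| != 1.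
Proof.
move=> nu_gt0 /rootP Drho; apply/eqP => rho1.
have rho0 : rho != 0 by rewrite -normr_eq0 rho1 oner_eq0.
have := horner_Dpoly k nu rho0; rewrite Drho mul0rn => /esym/eqP.
rewrite subr_eq0 => /eqP sumE.
have : `|\sum_(s < k) (rho ^+ s.+1 + rho^-1 ^+ s.+1)| <= 2 * k%:R.
  apply: le_trans (ler_norm_sum _ _ _) _.
  rewrite mulr_natr -[X in _ <= _ *+ X]card_ord -sumr_const; apply: ler_sum => s _.
  apply: le_trans (ler_normD _ _) _.
  by rewrite !normrX normfV rho1 invr1 expr1n.
rewrite -sumE ger0_norm; last by rewrite addr_ge0 ?mulr_ge0 ?ler0n // ltW.
by rewrite gerDl => /(lt_le_trans nu_gt0); rewrite ltxx.
Qed.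

End Chebyshev.

(** The expansion of [1/p] with denominators cleared: for [q i = p / (X - x i)] one has
    [q i (x i) = p'(x i)], so the summands are the Lagrange polynomials. *)
Lemma partial_fractions (F : fieldType) (n : nat) (p : {poly F})
    (x : 'I_n -> F) :
  (0 < n)%N -> injective x -> (size p <= n.+1)%N -> p != 0 ->
  (forall i, root p (x i)) ->
  exists q : 'I_n -> {poly F}, (forall i, p = ('X - (x i)%:P) * q i) /\
    \sum_i (p^`().[x i])^-1 *: q i = 1.
Proof.
move=> n_gt0 x_inj szp p0 px; pose rs := [seq x i | i <- enum 'I_n].
have rs_uniq : uniq rs by rewrite map_inj_uniq // enum_uniq.
have rs_root : all (root p) rs by apply/allP => _ /mapP[i _ ->].
have szrs : size rs = n by rewrite size_map size_enum_ord.
have szpE : size p = n.+1.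
  by apply/eqP; rewrite eqn_leq szp -szrs (max_poly_roots p0 rs_root).
have pE : p = lead_coef p *: \prod_i ('X - (x i)%:P).
  rewrite {1}(@all_roots_prod_XsubC _ p rs) ?szrs ?uniq_rootsE //.
  by rewrite big_map enumT.
have lc0 : lead_coef p != 0 by rewrite lead_coef_eq0.
pose q i := lead_coef p *: \prod_(j | j != i) ('X - (x j)%:P).
have pq i : p = ('X - (x i)%:P) * q i.
  by rewrite {1}pE (bigD1 i) //= scalerAr.
exists q; split=> //; rewrite -(sum_lagrange_poly x_inj n_gt0); apply: eq_bigr => i _.
rewrite {1}(pq i) derivM derivXsubC mul1r hornerD hornerM hornerXsubC subrr.
rewrite mul0r addr0 /q hornerZ horner_prod scalerA /lagrange_poly.
under eq_bigr do rewrite hornerXsubC.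
by rewrite invfM mulrC mulrA divff // mul1r.
Qed.

Section CycleGreenFunction.
Variables (F : numFieldType) (N : nat).
Hypothesis N_gt1 : (1 < N)%N.

(** For [|rho| < 1] this is the Green function [rho^|n| / (rho^-1 - rho)] of the integer line summed
    over the translates of [n] by multiples of [N]. *)
Definition cycle_green (rho : F) (n : nat) : F :=
  (rho ^+ n + rho ^+ (N - n)) / ((rho^-1 - rho) * (1 - rho ^+ N)).

Lemma cycle_greenP (rho : F) (x : 'Z_N) :
  rho != 0 -> rho ^+ 2 != 1 -> rho ^+ N != 1 ->
  (rho + rho^-1) * cycle_green rho x
  - (cycle_green rho (x + 1)%R + cycle_green rho (x - 1)%R) = (x == 0)%:R.
Proof.
move=> rho0 rho2 rhoN.
have rho20 : 1 + - rho * rho != 0 by rewrite mulNr -expr2 subr_eq0 eq_sym.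
have dif0 : rho^-1 - rho != 0.
  apply: contra_neq rho2 => /subr0_eq /esym; rewrite expr2 => {1}->.
  by rewrite mulVf.
have oneN0 : 1 - rho ^+ N != 0 by rewrite subr_eq0 eq_sym.
have xN : (x < N)%N by rewrite -[N in (_ < N)%N](Zp_cast N_gt1).
(* Wrap-around at [x.+1 = N] is harmless because the formula is invariant under [n -> N - n]. *)
have green_succ : cycle_green rho (x + 1)%R = cycle_green rho x.+1.
  rewrite -[x in LHS]natr_Zp natr1 val_Zp_nat //.
  have [->|xN1] := eqVneq x.+1 N; last by rewrite modn_small // ltn_neqAle xN1.
  by rewrite modnn /cycle_green subn0 subnn addrC.
rewrite green_succ; have [x0|x0] := eqVneq x 0.
  have -> : x - 1 = N.-1%:R.
    by apply: (addIr 1); rewrite subrK x0 natr1 prednK ?pchar_Zp // ltnW.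
  rewrite val_Zp_nat // modn_small ?ltn_predL ?(ltnW N_gt1) //.
  have -> : nat_of_ord x = 0%N by rewrite x0.
  rewrite /cycle_green.
  have -> : (N - N.-1 = 1)%N by lia.
  have -> : (N - 1 = N.-1)%N by lia.
  have NE : rho ^+ N = rho * rho ^+ N.-1 by rewrite -exprS prednK // ltnW.
  move: dif0 oneN0; rewrite subn0 NE; move: (rho ^+ N.-1) => p dif0 oneN0.
  rewrite !expr1 !expr0 /=; field.
  by rewrite rho0 oneN0 rho20.
have [y xy] : exists y, nat_of_ord x = y.+1.
  have : nat_of_ord x != 0%N by apply: contra_neq x0 => xE; exact: val_inj.
  by case: (nat_of_ord x) => // y _; exists y.
have -> : x - 1 = y%:R by rewrite -[x]natr_Zp xy -natr1 addrK.
rewrite val_Zp_nat // modn_small; last by rewrite -ltnS ltnW // -xy ltnS.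
rewrite xy /cycle_green in xN *.
have -> : (N - y = (N - y.+2).+2)%N by lia.
have -> : (N - y.+1 = (N - y.+2).+1)%N by lia.
rewrite !exprS; move: (rho ^+ y) (rho ^+ (N - y.+2)) => p q.
move: dif0 oneN0; move: (rho ^+ N) => z dif0 oneN0.
rewrite /=; field.
by rewrite rho0 oneN0 rho20.
Qed.

(** With this size the index type is ['Z_N] itself and the matrices form a ring. *)
Definition shift_mx (a : 'Z_N) : 'M[F]_((Zp_trunc N).+2) :=
  \matrix_(x, y) (y == x + a)%:R.

Lemma shift_mx_col (a : 'Z_N) (f : 'Z_N -> F) :
  shift_mx a *m (\col_x f x) = \col_x f (x + a).
Proof.
apply/colP => x; rewrite !mxE (bigD1 (x + a)) //= !mxE eqxx mul1r big1 ?addr0 //.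
by move=> y /negbTE yx; rewrite !mxE yx mul0r.
Qed.

Lemma shift_mxD (a b : 'Z_N) : shift_mx a * shift_mx b = shift_mx (a + b).
Proof.
apply/matrixP => x y; rewrite !mxE (bigD1 (x + a)) //= !mxE eqxx mul1r.
rewrite big1 ?addr0 ?addrA // => z /negbTE zx; by rewrite !mxE zx mul0r.
Qed.

Lemma shift_mx0 : shift_mx 0 = 1.
Proof. by apply/matrixP => x y; rewrite !mxE addr0 eq_sym. Qed.

Lemma shift_mxX (a : 'Z_N) (s : nat) : shift_mx a ^+ s = shift_mx (a *+ s).
Proof.
elim: s => [|s IHs]; first by rewrite expr0 mulr0n shift_mx0.
by rewrite exprS IHs shift_mxD mulrS.
Qed.

(* As [D = (X - phi_c) Q_c], applying [D(S + S^-1)] to the Green function of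
   [phi_c - S - S^-1] leaves [- Q_c(S + S^-1)] of the Dirac mass, and
   [sum_c Q_c / D'(phi_c) = 1]. *)
Lemma massive_green (k : nat) (nu : F) (rho : 'I_k -> F) :
  let D := Dpoly k nu in
  let phi c := rho c + (rho c)^-1 in
  let g x := - (2^-1) *
    \sum_c (D^`().[phi c])^-1 * cycle_green (rho c) (nat_of_ord x) in
  (0 < k)%N -> nu != 0 -> injective phi -> (forall c, root D (phi c)) ->
  (forall c, [/\ rho c != 0, rho c ^+ 2 != 1 & rho c ^+ N != 1]) ->
  forall x : 'Z_N,
    (2 * k%:R + nu) * g x - \sum_(s < k) (g (x + s.+1%:R)%R + g (x - s.+1%:R)%R)
    = (x == 0)%:R.
Proof.
move=> D phi g k_gt0 nu0 phi_inj Dphi rhoP.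
pose B := shift_mx 1 + shift_mx (-1).
have [Q [DQ sumQ]] := partial_fractions k_gt0 phi_inj (size_Dpoly k nu)
  (Dpoly_neq0 k nu0) Dphi.
pose delta : 'cV[F]_((Zp_trunc N).+2) := \col_x (x == 0 :> 'Z_N)%:R.
pose green c : 'cV[F]_((Zp_trunc N).+2) := \col_x cycle_green (rho c) (nat_of_ord x).
have greenE c : horner_mx B ('X - (phi c)%:P) *m green c = - delta.
  have [rho0 rho2 rhoN] := rhoP c.
  rewrite rmorphB /= horner_mx_X horner_mx_C mulmxBl mul_scalar_mx mulmxDl.
  rewrite !shift_mx_col; apply/colP => x; rewrite !mxE -(cycle_greenP x rho0 rho2 rhoN).
  by rewrite opprB.
have gE : \col_x g x = - (2^-1) *: \sum_c (D^`().[phi c])^-1 *: green c.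
  apply/colP => x; rewrite !mxE summxE; congr (_ * _); apply: eq_bigr => c _.
  by rewrite !mxE.
have Dg : horner_mx B D *m (\col_x g x) = 2^-1 *: delta.
  rewrite gE -scalemxAr mulmx_sumr.
  have -> : delta = - \sum_c (D^`().[phi c])^-1 *: (horner_mx B (Q c) *m - delta).
    under eq_bigr do rewrite mulmxN scalerN scalemxAl -horner_mxZ.
    by rewrite sumrN opprK -mulmx_suml -rmorph_sum sumQ rmorph1 mul1mx.
  rewrite scaleNr scalerN; congr (- (_ *: _)); apply: eq_bigr => c _.
  rewrite -scalemxAr -(greenE c) mulmxA; congr (_ *: (_ *m _)).
  by rewrite [_ *m _](_ : _ = horner_mx B (Q c) * horner_mx B ('X - (phi c)%:P)) //
    -rmorphM mulrC -DQ.
have SS : shift_mx 1 * shift_mx (-1) = 1 by rewrite shift_mxD subrr shift_mx0.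
have S'S : shift_mx (-1) * shift_mx 1 = 1 by rewrite shift_mxD addNr shift_mx0.
have DB := rmorph_Dpoly k nu SS S'S (horner_mx_X B).
(* Doubling turns [D(B)] into [L_C + nu] and absorbs the [2^-1] in [g]. *)
move=> x; have /colP/(_ x) : horner_mx B D *+ 2 *m (\col_x g x) = delta.
  by rewrite -scaler_nat -scalemxAl Dg scalerA divff ?scale1r // pnatr_eq0.
rewrite DB /= horner_mx_C mulmxBl mul_scalar_mx mulmx_suml !mxE => <-.
congr (_ - _); rewrite summxE; apply: eq_bigr => s _.
by rewrite !shift_mxX mulmxDl !shift_mx_col !mxE mulNrn.
Qed.

End CycleGreenFunction.

(** Binet's formula, multiplied out so that it also holds for [eta = eta^-1]. *)
Lemma Vseq_expr (F : fieldType) (eta : F) (n : nat) : eta != 0 ->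
  Vseq (eta + eta^-1) n * (eta - eta^-1) = eta ^+ n - eta^-1 ^+ n.
Proof.
move=> eta0; have [] : Vseq (eta + eta^-1) n * (eta - eta^-1) = eta ^+ n - eta^-1 ^+ n
  /\ Vseq (eta + eta^-1) n.+1 * (eta - eta^-1) = eta ^+ n.+1 - eta^-1 ^+ n.+1; last by [].
elim: n => [|n [IH1 IH2]]; first by rewrite /= mul0r mul1r !expr0 subrr !expr1.
split=> //; rewrite [Vseq _ _]/= mulrBl -mulrA IH2 IH1 !exprS.
by move: (eta ^+ n) (eta^-1 ^+ n) => p q; field.
Qed.

(** The numerator factors as [(1 - rho^l)(1 - rho^(N-l))]. Each [1 - rho^n] is
    [- eta^n (eta - eta^-1) V_n], and [rho^-1 - rho] is [- gamma (eta - eta^-1)]. *)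
Lemma cycle_green_diff (F : numFieldType) (N l : nat) (rho eta : F) :
  (l <= N)%N -> rho != 0 -> rho ^+ 2 != 1 -> rho ^+ N != 1 -> eta ^+ 2 = rho ->
  let gamma := eta + eta^-1 in
  cycle_green N rho 0 - cycle_green N rho l =
  gamma^-1 * (Vseq gamma l * Vseq gamma (N - l) / Vseq gamma N).
Proof.
move=> lN rho0 rho2 rhoN etaE gamma.
have eta0 : eta != 0 by apply: contra_neq rho0 => eta0; rewrite -etaE eta0 expr0n.
have eta_1 : eta ^+ 2 != 1 by apply: contra_neq rho2; rewrite etaE => ->; rewrite expr1n.
have eta_m1 : eta ^+ 2 + 1 != 0.
  rewrite addr_eq0; apply: contra_neq rho2; rewrite etaE => ->.
  by rewrite sqrrN expr1n.
have w0 : eta - eta^-1 != 0.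
  apply: contra_neq eta_1 => /subr0_eq etaV; by rewrite expr2 {2}etaV mulfV.
have VE n : Vseq gamma n = (eta ^+ n - (eta ^+ n)^-1) / (eta - eta^-1).
  by rewrite -exprVn -Vseq_expr // mulfK.
rewrite /cycle_green !VE /gamma subn0 expr0.
have -> : eta ^+ N = eta ^+ l * eta ^+ (N - l) by rewrite -exprD subnKC.
have -> : rho ^+ N = rho ^+ l * rho ^+ (N - l) by rewrite -exprD subnKC.
have pNE : rho ^+ N = (eta ^+ l * eta ^+ (N - l)) ^+ 2.
  by rewrite -etaE -exprD subnKC // -!exprM mulnC.
move: rhoN; rewrite pNE -etaE -!exprM ![(2 * _)%N]mulnC !exprM.
have : eta ^+ l != 0 by rewrite expf_neq0.
have : eta ^+ (N - l) != 0 by rewrite expf_neq0.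
move: (eta ^+ l) (eta ^+ (N - l)) => p q q0 p0 pq1.
field.
rewrite -!expr2 !mulNr eta0 q0 p0 !subr_eq0 pq1 eta_1 eta_m1.
by rewrite eq_sym pq1 -expr2 etaE eq_sym rho2.
Qed.

(** * Walk-regular graphs and Cartesian products *)

Lemma laplacian_mulmx (R : pzRingType) (V : finType) (e : rel V) (r n : nat)
    (M : 'M[R]_(#|V|, n)) (x : V) (j : 'I_n) :
  (laplacian R e r *m M) (enum_rank x) j =
  r%:R * M (enum_rank x) j - \sum_(y | e x y) M (enum_rank y) j.
Proof.
rewrite /laplacian mulmxBl mul_scalar_mx !mxE; congr (_ - _).
rewrite (reindex enum_rank) /=; last by apply: onW_bij; exact: enum_rank_bij.
rewrite [RHS]big_mkcond; apply: eq_bigr => y _; rewrite mxE !enum_rankK.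
by case: (e x y); rewrite ?mul1r ?mul0r.
Qed.

Lemma laplacian_tr (R : comPzRingType) (V : finType) (e : rel V) (r : nat) :
  symmetric e -> (laplacian R e r)^T = laplacian R e r.
Proof.
move=> esym; rewrite /laplacian linearB /= tr_scalar_mx; congr (_ - _).
by apply/matrixP => x y; rewrite !mxE esym.
Qed.

Lemma walk_regular_laplacian (R : comPzRingType) (V : finType) (e : rel V)
    (r q : nat) (a b : V) : walk_regular e ->
  (laplacian R e r ^+ q) (enum_rank a) (enum_rank a) =
  (laplacian R e r ^+ q) (enum_rank b) (enum_rank b).
Proof.
move=> ewalk; pose A := adjacency R e; pose L := laplacian R e r.
have Adiag p : (A ^+ p) (enum_rank a) (enum_rank a) = (A ^+ p) (enum_rank b) (enum_rank b).
  have -> : A ^+ p = map_mx intr (adjacency int e ^+ p).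
    elim: p => [|p IHp]; first by rewrite !expr0 map_mx1.
    rewrite !exprS [RHS]map_mxM IHp; congr (_ *m _).
    by apply/matrixP => x y; rewrite !mxE rmorph_nat.
  by rewrite !mxE (ewalk p a b).
(* Mixed products let the induction trade one factor [L = r - A] at a time for powers of [A]. *)
suff H j p : (L ^+ j * A ^+ p) (enum_rank a) (enum_rank a) =
             (L ^+ j * A ^+ p) (enum_rank b) (enum_rank b).
  by have := H q 0%N; rewrite expr0 mulr1.
elim: j p => [|j IHj] p; first by rewrite expr0 mul1r.
have -> : L ^+ j.+1 * A ^+ p = r%:R *: (L ^+ j * A ^+ p) - L ^+ j * A ^+ p.+1.
  rewrite exprSr -mulrA [L * _](_ : _ = r%:R *: A ^+ p - A ^+ p.+1).
    by rewrite [LHS]mulmxBr -scalemxAr.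
  by rewrite exprS [LHS]mulmxBl mul_scalar_mx.
have entry (c : R) (X Y : 'M[R]_#|V|) x : (c *: X - Y) x x = c * X x x - Y x x.
  by rewrite !mxE.
by rewrite !entry !IHj.
Qed.

(** [p al a] is column [a] of a spectral projection. Its diagonal is constant with trace the
    multiplicity; the [#|V|%:R^-1] is the omitted projection onto constants. *)
Lemma laplacian_projections (R : rcfType) (V : finType) (e : rel V) (r t : nat)
    (nu : 'I_t.+1 -> R) :
  symmetric e -> connected_graph e -> regular_graph e r -> walk_regular e ->
  nu ord0 = 0 -> injective nu ->
  (forall x, eigenvalue (laplacian R e r) x -> exists j, nu j = x) ->
  exists p : 'I_t -> V -> V -> R,
    [/\ forall al a b,
          r%:R * p al a b - \sum_(c | e b c) p al a c = nu (lift ord0 al) * p al a b,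
        forall a b, \sum_al p al a b = (b == a)%:R - #|V|%:R^-1 &
        forall al a, p al a a =
          (\rank (eigenspace (laplacian R e r) (nu (lift ord0 al))))%:R / #|V|%:R].
Proof.
move=> esym [V0 econn] ereg ewalk nu0 nu_inj nuP.
have LT := laplacian_tr R r esym.
have [E [sumE LE trE polyE vE]] := symmetric_mx_spectral_projections LT nu_inj nuP.
have cardV : #|V|%:R != 0 :> R by rewrite pnatr_eq0 -lt0n.
have diagE j a b : E j (enum_rank a) (enum_rank a) = E j (enum_rank b) (enum_rank b).
  have [q [c ->]] := polyE j; rewrite !summxE; apply: eq_bigr => s _.
  by rewrite !mxE (walk_regular_laplacian _ _ _ a b ewalk).
have LEE j a b : r%:R * E j (enum_rank b) a - \sum_(c | e b c) E j (enum_rank c) a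
    = nu j * E j (enum_rank b) a.
  by rewrite -laplacian_mulmx LE mxE.
exists (fun al a b => E (lift ord0 al) (enum_rank b) (enum_rank a)); split.
- by move=> al a b; rewrite LEE.
- move=> a b.
  have -> : \sum_al E (lift ord0 al) (enum_rank b) (enum_rank a) =
      (1%:M : 'M[R]_#|V|) (enum_rank b) (enum_rank a) - E ord0 (enum_rank b) (enum_rank a).
    by rewrite -sumE big_ord_recl mxE summxE [RHS]addrC addKr.
  rewrite mxE (inj_eq enum_rank_inj); congr (_ - _).
  (* Columns of the projection at eigenvalue [0] are harmonic, hence constant by connectedness. *)
  have E0const c : E ord0 (enum_rank c) (enum_rank a) = E ord0 (enum_rank a) (enum_rank a).
    apply/eqP; rewrite -subr_eq0; apply/eqP.
    apply: (harmonic_off_eq0 ereg econn (v := a) (f := fun c =>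
      E ord0 (enum_rank c) (enum_rank a) - E ord0 (enum_rank a) (enum_rank a))).
      by rewrite subrr.
    move=> x _; rewrite mulrBr sumrB (sum_neighbors_const ereg) opprB addrA subrK.
    by rewrite LEE nu0 mul0r.
  (* The all-ones row is fixed by [E ord0], so each column of [E ord0] sums to [1]. *)
  have one_L : const_mx 1 *m laplacian R e r = nu ord0 *: const_mx 1 :> 'rV_#|V|.
    apply/trmx_inj; rewrite nu0 scale0r trmx0 trmx_mul LT trmx_const.
    apply/colP => x; rewrite -[x]enum_valK laplacian_mulmx !mxE.
    under eq_bigr do rewrite mxE.
    by rewrite (sum_neighbors_const ereg) subrr.
  have := vE _ ord0 _ one_L; rewrite eqxx scale1r => /rowP/(_ (enum_rank a)).
  rewrite !mxE (reindex enum_rank) /=; last by apply: onW_bij; exact: enum_rank_bij.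
  under eq_bigr do rewrite mxE mul1r E0const.
  rewrite sumr_const E0const -[_ *+ _]mulr_natl => /(canRL (mulKf cardV)) ->.
  by rewrite mulr1.
- move=> al a; rewrite -trE /mxtrace.
  rewrite (reindex enum_rank) /=; last by apply: onW_bij; exact: enum_rank_bij.
  under eq_bigr do rewrite (diagE _ _ a).
  by rewrite sumr_const -[_ *+ _]mulr_natr mulfK.
Qed.

Section CartesianProduct.
Context (W V : finType) (e : rel W) (f : rel V).
Hypotheses (eirr : irreflexive e) (firr : irreflexive f).

(** Irreflexivity keeps the two kinds of neighbours disjoint. *)
Lemma sum_cartesian_product (M : nmodType) (h : W * V -> M) (x : W) (b : V) :
  \sum_(p | cartesian_product e f (x, b) p) h p =
  \sum_(y | e x y) h (y, b) + \sum_(c | f b c) h (x, c).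
Proof.
rewrite (bigID (fun p => p.2 == b)) /=; congr (_ + _).
  rewrite (reindex_onto (fun y => (y, b)) fst) /= => [|[y c] /= /andP[_ /eqP->] //].
  by apply: eq_bigl => y; rewrite /cartesian_product /= !eqxx firr !andbF orbF !andbT.
rewrite (reindex_onto (fun c => (x, c)) snd) /=; last first.
  move=> [y c] /= /andP[]; rewrite /cartesian_product /= eq_sym.
  by case/orP => /andP[/eqP-> //]; rewrite eqxx.
apply: eq_bigl => c; rewrite /cartesian_product /= !eqxx eirr andbF /= andbT.
by have [->|//] := eqVneq c b; rewrite ?firr // andbT.
Qed.

Lemma regular_cartesian_product (q r : nat) : regular_graph e q ->
  regular_graph f r -> regular_graph (cartesian_product e f) (q + r).
Proof.
move=> ereg freg [x b]; rewrite /degree -sum1_card.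
rewrite (sum_cartesian_product (fun=> 1%N)) !sum1_card.
by congr (_ + _)%N; [exact: ereg|exact: freg].
Qed.

End CartesianProduct.

Lemma sum_laplacian_eq0 (R : realFieldType) (W : finType) (e : rel W) (q : nat)
    (h : W -> R) : symmetric e -> regular_graph e q ->
  \sum_x (q%:R * h x - \sum_(y | e x y) h y) = 0.
Proof.
move=> esym ereg; rewrite sumrB; apply/eqP; rewrite subr_eq0; apply/eqP.
under [RHS]eq_bigr do rewrite big_mkcond.
rewrite exchange_big; apply: eq_bigr => y _; rewrite -(sum_neighbors_const ereg y).
by rewrite big_mkcond; apply: eq_bigr => x _; rewrite esym.
Qed.

(** The Laplacian of any function sums to [0], which forces its value at [v]. *)
Lemma poisson_full (R : realFieldType) (W : finType) (e : rel W) (q : nat)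
    (v : W) (h : W -> R) : symmetric e -> regular_graph e q ->
  (forall x, x != v -> q%:R * h x - \sum_(y | e x y) h y = q%:R) ->
  forall x, q%:R * h x - \sum_(y | e x y) h y =
    q%:R - #|W|%:R * q%:R * (x == v)%:R.
Proof.
move=> esym ereg hE x; have [->|xv] := eqVneq x v; last by rewrite mulr0 subr0 hE.
have := sum_laplacian_eq0 h esym ereg; rewrite (bigD1 v) //=.
rewrite (eq_bigr _ hE).
rewrite sumr_const cardC1 => /eqP; rewrite addr_eq0 => /eqP ->.
have W0 : (0 < #|W|)%N by apply/card_gt0P; exists v.
by rewrite mulr1 -{2}(prednK W0) -natr1 mulrDl mul1r opprD addrCA subrr addr0 mulr_natl.
Qed.

(* [p al] plays the role of the spectral projections of the Laplacian of [f] at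
   its nonzero eigenvalues, so the right-hand side of the last equation is
   [1 - #|W * V| * delta_(v, a)] up to the degree. *)
Lemma cartesian_product_poisson (R : realFieldType) (W V : finType) (e : rel W)
    (f : rel V) (q r t : nat) (v : W) (a : V) (hW : W -> R) (nu : 'I_t -> R)
    (g : 'I_t -> W -> R) (p : 'I_t -> V -> R) :
  irreflexive e -> irreflexive f -> regular_graph e q -> regular_graph f r ->
  (0 < q)%N ->
  (forall x, q%:R * hW x - \sum_(y | e x y) hW y =
     q%:R - #|W|%:R * q%:R * (x == v)%:R) ->
  (forall al x, (q%:R + nu al) * g al x - \sum_(y | e x y) g al y = (x == v)%:R) ->
  (forall al b, r%:R * p al b - \sum_(c | f b c) p al c = nu al * p al b) ->
  (forall b, \sum_al p al b = (b == a)%:R - #|V|%:R^-1) ->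
  forall x b, let h z := (q + r)%:R / q%:R * hW z.1
    - ((q + r) * #|W| * #|V|)%:R * \sum_al g al z.1 * p al z.2 in
  (q + r)%:R * h (x, b)
  - \sum_(z | cartesian_product e f (x, b) z) h z =
  (q + r)%:R - ((q + r) * #|W| * #|V|)%:R * ((x, b) == (v, a))%:R.
Proof.
move=> eirr firr ereg freg q_gt0 hWE gE pE sump x b h.
have q0 : q%:R != 0 :> R by rewrite pnatr_eq0 -lt0n.
have V0 : #|V|%:R != 0 :> R.
  by rewrite pnatr_eq0 -lt0n; apply/card_gt0P; exists a.
rewrite sum_cartesian_product //.
(* The Laplacian splits into one along [e] and one along [f]. The terms [nu al * g al x * p al b]
   cancel between [he] and [hf], and the [#|V|%:R^-1] of [sump] cancels the source of [hW]. *)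
have he : q%:R * h (x, b) - \sum_(y | e x y) h (y, b) =
    (q + r)%:R / q%:R * (q%:R - #|W|%:R * q%:R * (x == v)%:R)
    - ((q + r) * #|W| * #|V|)%:R *
      \sum_al ((x == v)%:R - nu al * g al x) * p al b.
  rewrite -hWE sumrB -!mulr_sumr exchange_big /=.
  rewrite [in RHS](eq_bigr (fun al =>
    q%:R * (g al x * p al b) - \sum_(y | e x y) g al y * p al b)); last first.
    by move=> al _; rewrite -(gE al x) -mulr_suml; ring.
  rewrite sumrB -mulr_sumr /h /=; ring.
have hf : r%:R * h (x, b) - \sum_(c | f b c) h (x, c) =
    - ((q + r) * #|W| * #|V|)%:R * \sum_al nu al * g al x * p al b.
  rewrite sumrB /= (sum_neighbors_const freg) -!mulr_sumr exchange_big /=.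
  rewrite [in RHS](eq_bigr (fun al =>
    r%:R * (g al x * p al b) - \sum_(c | f b c) g al x * p al c)); last first.
    by move=> al _; rewrite mulrAC -(pE al b) -mulr_sumr; ring.
  rewrite sumrB -mulr_sumr /h /=; ring.
have -> : (q + r)%:R * h (x, b) - (\sum_(y | e x y) h (y, b) + \sum_(c | f b c) h (x, c))
  = (q%:R * h (x, b) - \sum_(y | e x y) h (y, b)) +
    (r%:R * h (x, b) - \sum_(c | f b c) h (x, c)) by rewrite natrD; ring.
rewrite he hf.
have -> : \sum_al ((x == v)%:R - nu al * g al x) * p al b =
    (x == v)%:R * ((b == a)%:R - #|V|%:R^-1) - \sum_al nu al * g al x * p al b.
  by rewrite -sump mulr_sumr -sumrB; apply: eq_bigr => al _; rewrite mulrBl.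
rewrite xpair_eqE !natrM.
have -> : ((x == v) && (b == a))%:R = (x == v)%:R * (b == a)%:R :> R.
  by case: (x == v); rewrite ?mul1r ?mul0r.
move: (\sum_al _) ((x == v)%:R : R) ((b == a)%:R : R) => S i j.
by field; rewrite q0 V0.
Qed.

(** Single summands may be nonreal, but the equation has real coefficients, so the imaginary part of
    the sum solves the homogeneous one and vanishes by [massive_laplacian_inj]. *)
Lemma real_massive_green (R : rcfType) (N k : nat) (nu : R) (rho : 'I_k -> R[i]) :
  let D := Dpoly k nu%:C in
  let phi c := rho c + (rho c)^-1 in
  (0 < k)%N -> (2 * k + 1 <= N)%N -> 0 < nu -> injective phi ->
  (forall c, root D (phi c)) ->
  (forall c, [/\ rho c != 0, rho c ^+ 2 != 1 & rho c ^+ N != 1]) ->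
  exists g : 'Z_N -> R,
    (forall x, ((2 * k)%:R + nu) * g x - \sum_(y | cycle_power k x y) g y
       = (x == 0)%:R) /\
    forall x, (g x)%:C = - (2^-1) *
      \sum_c (D^`().[phi c])^-1 * cycle_green N (rho c) (nat_of_ord x).
Proof.
move=> D phi k_gt0 Nk nu_gt0 phi_inj Dphi rhoP.
have N_gt1 : (1 < N)%N by lia.
have nuC0 : nu%:C != 0 by rewrite (fmorph_eq0 (real_complex R)) gt_eqF.
pose G (x : 'Z_N) := - (2^-1) *
  \sum_c (D^`().[phi c])^-1 * cycle_green N (rho c) (nat_of_ord x).
have GE : forall x, _ = _ := massive_green N_gt1 k_gt0 nuC0 phi_inj Dphi rhoP.
have ReE (c : R) (z : R[i]) : complex.Re (c%:C * z) = c * complex.Re z.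
  by case: z => x y; simpc.
have ImE (c : R) (z : R[i]) : complex.Im (c%:C * z) = c * complex.Im z.
  by case: z => x y; simpc.
have ReB (x y : R[i]) : complex.Re (x - y) = complex.Re x - complex.Re y by case: x; case: y.
have ImB (x y : R[i]) : complex.Im (x - y) = complex.Im x - complex.Im y by case: x; case: y.
have ReS (P : pred 'Z_N) (F : 'Z_N -> R[i]) :
    complex.Re (\sum_(y | P y) F y) = \sum_(y | P y) complex.Re (F y).
  by apply: (big_morph (@complex.Re R)) => [[x y] [x' y']|].
have ImS (P : pred 'Z_N) (F : 'Z_N -> R[i]) :
    complex.Im (\sum_(y | P y) F y) = \sum_(y | P y) complex.Im (F y).
  by apply: (big_morph (@complex.Im R)) => [[x y] [x' y']|].
have GE' x : ((2 * k)%:R + nu)%:C * G x - \sum_(y | cycle_power k x y) G y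
    = (x == 0)%:R%:C.
  rewrite (sum_cycle_power k_gt0 Nk) natrM rmorphD rmorphM /= !rmorph_nat.
  exact: GE.
have ImG : (fun x => complex.Im (G x)) =1 fun=> 0.
  apply: (massive_laplacian_inj (regular_cycle_power k_gt0 Nk) nu_gt0) => x.
  by rewrite -ImE -ImS -ImB GE'.
exists (fun x => complex.Re (G x)); split=> x.
  by rewrite -ReE -ReS -ReB GE'.
by rewrite -[RHS]/(G x) [RHS]complexE [complex.Im _]ImG mulr0 addr0.
Qed.

(** * Assembly of the hitting time formula *)

Lemma symmetric_cycle_power (N k : nat) : symmetric (@cycle_power N k).
Proof.
move=> x y; rewrite /cycle_power; apply: eq_existsb => s.
by rewrite -[y - x]opprB eqr_oppLR eqr_opp orbC.
Qed.

Lemma irreflexive_cycle_power (N k : nat) : (2 * k + 1 <= N)%N ->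
  irreflexive (@cycle_power N k).
Proof.
move=> Nk x; apply/negbTE/existsP => -[s]; have sk := ltn_ord s.
rewrite subrr [0 == - _]eq_sym oppr_eq0 eq_sym orbb => /eqP/(@natr_Zp_inj N _ 0).
by lia.
Qed.

Theorem corollary4p15 (R : realType) (N k r : nat)
  (N_gt0 : (0 < N)%N) (k_gt0 : (0 < k)%N) (Nk : (2 * k + 1 <= N)%N)
  (* the graph G *)
  (V : finType) (e : rel V)
  (Gsimple : simple_graph e) (Gconn : connected_graph e)
  (Greg : regular_graph e r)
  (* the distinct eigenvalues of the Laplacian of G *)
  (t : nat) (nu : 'I_t.+1 -> R)
  (nu0 : nu ord0 = 0)
  (nu_lt : forall i j : 'I_t.+1, (i < j)%N -> nu i < nu j)
  (nuP : forall x : R,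
     eigenvalue (laplacian R e r) x <-> exists i, nu i = x)
  (* index al : 'I_t stands for the nonzero eigenvalue nu (lift ord0 al) *)
  (D : 'I_t -> {poly R[i]})
  (DE : forall al, D al = Dpoly k (nu (lift ord0 al))%:C)
  (Dsimple : forall al (x : R[i]), root (D al) x -> mup x (D al) = 1%N)
  (phi : 'I_t -> 'I_k -> R[i])
  (phi_inj : forall al, injective (phi al))
  (phiP : forall al (x : R[i]), root (D al) x <-> exists c, phi al c = x)
  (rho eta gamma : 'I_t -> 'I_k -> R[i])
  (rho_neq0 : forall al c, rho al c != 0)
  (rhoP : forall al c, rho al c + (rho al c)^-1 = phi al c)
  (etaP : forall al c, eta al c ^+ 2 = rho al c)
  (gammaE : forall al c, gamma al c = eta al c + (eta al c)^-1)
  (Gwalk : walk_regular e)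
  (l : nat) (lN : (l <= N - 1)%N)
  (* a simple random walk on C_N^k started at 0 *)
  (dC : measure_display) (OmegaC : measurableType dC)
  (PC : probability OmegaC R) (W : nat -> OmegaC -> 'Z_N)
  (Wsrw : simple_random_walk (@cycle_power N k) PC W 0) :
  let X := cartesian_product (@cycle_power N k) e in
  let hC : \bar R := mean_hitting_time PC W l%:R in
  let rhs : R[i] :=
    (2 * k + r)%:R / (2 * k)%:R * (fine hC)%:C
    - (N * (2 * k + r))%:R / 2%:R *
      \sum_(al < t)
        (\rank (eigenspace (laplacian R e r) (nu (lift ord0 al))))%:R *
        \sum_(c < k)
          (1 / (gamma al c * (D al)^`().[phi al c])) *
          (Vseq (gamma al c) l * Vseq (gamma al c) (N - l)
           / Vseq (gamma al c) N) in
  hC \is a fin_num /\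
  (* for every vertex a and every simple random walk on X from (0, a) *)
  forall (a : V) (d : measure_display) (Omega : measurableType d)
    (P : probability Omega R) (Z : nat -> Omega -> ('Z_N * V)%type),
    simple_random_walk X P Z (0, a) ->
    let hX : \bar R := mean_hitting_time P Z (l%:R, a) in
    hX \is a fin_num /\ (fine hX)%:C = rhs.
Proof.
move=> X hC rhs.
have N_gt1 : (1 < N)%N by lia.
have lN' : (l < N)%N by lia.
have cardN : #|'Z_N| = N by rewrite card_ord Zp_cast.
pose v : 'Z_N := l%:R.
have val_v : nat_of_ord v = l by rewrite val_Zp_nat // modn_small.
have Creg := regular_cycle_power k_gt0 Nk.
have Cirr := irreflexive_cycle_power Nk.
have Csym := @symmetric_cycle_power N k.
have Cdeg : (0 < 2 * k)%N by rewrite muln_gt0.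
have [h [hv hE]] := exists_poisson R Creg (connected_cycle_power k_gt0) v.
have hC_E : hC = (h 0)%:E by exact: mean_hitting_time_regular Wsrw hv hE.
split; first by rewrite hC_E.
move=> a d Omega P Z Zsrw hX.
have [esym eirr] := Gsimple.
have V0 : #|V|%:R != 0 :> R by rewrite pnatr_eq0 -lt0n; case: Gconn.
have nu_inj : injective nu.
  move=> i1 i2 nuE; apply/val_inj; case: (ltngtP i1 i2) => // /nu_lt.
    by rewrite nuE ltxx.
  by rewrite nuE ltxx.
have [p [pE sump diagp]] := laplacian_projections esym Gconn Greg Gwalk nu0 nu_inj
  (fun x => iffLR (nuP x)).
have nu_gt0 al : 0 < nu (lift ord0 al) by rewrite -nu0 nu_lt.
have rho_phi al : phi al =1 fun c => rho al c + (rho al c)^-1 by move=> c; rewrite rhoP.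
have Droot al c : root (Dpoly k (nu (lift ord0 al))%:C) (rho al c + (rho al c)^-1).
  by rewrite rhoP -DE; apply/phiP; exists c.
have rho_n al c n : (0 < n)%N -> rho al c ^+ n != 1.
  move=> n_gt0; have nuC : 0 < (nu (lift ord0 al))%:C by rewrite ltcR.
  apply: contra_neq (Dpoly_root_norm_neq1 nuC (Droot al c)) => rho1.
  by apply/eqP; rewrite -(@pexpr_eq1 _ _ n) // -normrX rho1 normr1.
have phi_inj' al : injective (fun c => rho al c + (rho al c)^-1).
  by move=> c c'; rewrite -!rho_phi => /phi_inj.
have /(_ _)/cid green al := real_massive_green k_gt0 Nk (nu_gt0 al) (@phi_inj' al)
  (Droot al) (fun c => And3 (rho_neq0 al c) (rho_n al c 2%N isT) (rho_n al c N N_gt0)).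
(* The reflection moves the source from [0] to [v]; then [g al 0] is the Green function at [l] and
   [g al v] the one at [0]. *)
pose g al x := projT1 (green al) (v - x).
have gE al x : ((2 * k)%:R + nu (lift ord0 al)) * g al x
    - \sum_(y | cycle_power k x y) g al y = (x == v)%:R.
  have [+ _] := projT2 (green al) => /(_ (v - x)); rewrite subr_eq0 eq_sym => <-.
  congr (_ - _); rewrite !(sum_cycle_power k_gt0 Nk); apply: eq_bigr => s _.
  by rewrite addrC /g !opprD opprK !addrA.
have hFE := @poisson_full _ _ _ _ _ _ Csym Creg hE.
pose H (z : 'Z_N * V) := (2 * k + r)%:R / (2 * k)%:R * h z.1
  - ((2 * k + r) * #|'Z_N| * #|V|)%:R * \sum_al g al z.1 * p al a z.2.
have XE x b : (2 * k + r)%:R * H (x, b) - \sum_(z | X (x, b) z) H z =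
    (2 * k + r)%:R - ((2 * k + r) * #|'Z_N| * #|V|)%:R * ((x, b) == (v, a))%:R.
  exact: (cartesian_product_poisson (a := a) Cirr eirr Creg Greg Cdeg hFE gE
    (fun al b => pE al a b) (sump a)).
have Xreg : regular_graph X (2 * k + r) by exact: regular_cartesian_product.
(* Subtracting a constant keeps the Poisson equation and makes the function vanish at the target. *)
have hX_E : hX = (H (0, a) - H (v, a))%:E.
  apply: (mean_hitting_time_regular (h := fun z => H z - H (v, a)) Xreg _ Zsrw).
  - by rewrite addn_gt0 Cdeg.
  - by rewrite subrr.
  move=> [x b] /negbTE xb; rewrite mulrBr sumrB (sum_neighbors_const Xreg).
  by rewrite opprB addrA subrK XE xb mulr0 subr0.
rewrite hX_E; split=> //=.
have g_diff al : (g al 0 - g al v)%:C = 2^-1 * \sum_(c < k)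
    (1 / (gamma al c * (D al)^`().[phi al c])) *
    (Vseq (gamma al c) l * Vseq (gamma al c) (N - l) / Vseq (gamma al c) N).
  have [_ GE] := projT2 (green al).
  rewrite /g subr0 subrr rmorphB /= !GE val_v !mulNr opprK addrC -mulrBr -sumrB.
  congr (_ * _); apply: eq_bigr => c _; rewrite -mulrBr.
  rewrite (@cycle_green_diff _ _ _ _ (eta al c)) ?rho_n ?(ltnW lN') //.
  rewrite -gammaE DE rhoP div1r invfM.
  by rewrite mulrA [_ * (gamma al c)^-1]mulrC.
have -> : H (0, a) - H (v, a) = (2 * k + r)%:R / (2 * k)%:R * h 0
    - ((2 * k + r) * N)%:R *
      \sum_al (\rank (eigenspace (laplacian R e r) (nu (lift ord0 al))))%:R *
              (g al 0 - g al v).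
  (* This is where [a] disappears: start and target share the [V]-coordinate, so only diagonal
     entries of the projections occur. *)
  have sum_diag z : \sum_al g al z * p al a a =
      (\sum_al (\rank (eigenspace (laplacian R e r) (nu (lift ord0 al))))%:R * g al z)
      / #|V|%:R.
    by rewrite mulr_suml; apply: eq_bigr => al _; rewrite diagp mulrA [g al z * _]mulrC.
  under [in RHS]eq_bigr do rewrite mulrBr.
  rewrite sumrB /H /= !sum_diag hv cardN !natrM; field.
  by rewrite V0 pnatr_eq0 -lt0n k_gt0.
rewrite /rhs hC_E; move: (2 * k + r)%N (2 * k)%N => q1 q2.
rewrite rmorphB !rmorphM fmorphV rmorph_sum !rmorph_nat /=.
congr (_ - _); rewrite [_%:R * N%:R]mulrC -[RHS]mulrA; congr (_ * _); rewrite mulr_sumr.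
apply: eq_bigr => al _; rewrite rmorphM rmorph_nat /= g_diff mulrCA //.
Qed.
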